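(* Let $(\Gamma_1(t),\Gamma_2(t),\Gamma_3(t))_{t\in[0,T)}$, $T>0$, be a sufficiently smooth solution of the coupled evolution problem described in the context. Then the total free energy $\mathbb E(t)$ is non-increasing with respect to time $t$.
   Context: **Parameters.** $\mathcal A,\mathcal B>0$ are constants; $\gamma_{ex}>0$, $0\le\gamma_{gb}<2\gamma_{ex}$, $\gamma_{gas},\gamma_{grs}$ are constants (surface free energies) with $|\gamma_{gas}-\gamma_{grs}|\le\gamma_{ex}$; $\beta=\arccos(-\gamma_{gb}/(2\gamma_{ex}))\in[\pi/2,\pi)$ and $\theta_c=\arccos((\gamma_{gas}-\gamma_{grs})/\gamma_{ex})\in[0,\pi]$. **Evolution problem.** For $t\in[0,T)$, $\Gamma_i(t)=\{(r_i(\alpha,t),z_i(\alpha,t)):\alpha\in[0,1]\}$, $i=1,2,3$, where $r_i,z_i$ are sufficiently smooth on $[0,1]\times[0,T)$ ($C^\infty$ may be assumed), $r_{i\alpha}^2+z_{i\alpha}^2>0$, and $r_{i\alpha}r_{i\alpha\alpha}+z_{i\alpha}z_{i\alpha\alpha}=0$. Let $H_i=\frac{r_{i\alpha}z_{i\alpha\alpha}-z_{i\alpha}r_{i\alpha\alpha}}{2(r_{i\alpha}^2+z_{i\alpha}^2)^{3/2}}+\frac{z_{i\alpha}}{2r_i\sqrt{r_{i\alpha}^2+z_{i\alpha}^2}}$, $\hat\tau_i=(r_{i\alpha},z_{i\alpha})/\sqrt{r_{i\alpha}^2+z_{i\alpha}^2}$, and let $\theta_i$ be continuous with values in $(-\pi,\pi]$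 and $\hat\tau_i=(\cos\theta_i,\sin\theta_i)$. Equations of motion for $\alpha\in(0,1)$, $t\in(0,T)$: $r_{i\alpha}z_{it}-z_{i\alpha}r_{it}=\frac{-\mathcal B(r_iH_{i\alpha})_\alpha}{r_i\sqrt{r_{i\alpha}^2+z_{i\alpha}^2}}$ for $i=1,2$, and $r_{3\alpha}z_{3t}-z_{3\alpha}r_{3t}=\mathcal A\sqrt{r_{3\alpha}^2+z_{3\alpha}^2}\,H_3$. Boundary conditions for $t\in[0,T)$: $(r_1,z_1)(0,t)=(r_1^*(t),0)$, $(r_1,z_1)(1,t)=(r_2,z_2)(0,t)=(r_3,z_3)(1,t)=(\bar r(t),\bar z(t))$, $(r_2,z_2)(1,t)=(1,z_2^*(t))$, $(r_3,z_3)(0,t)=(r_3^*(t),0)$, with $0<r_1^*<r_3^*<1$, $z_2^*>0$, $0<\bar r<1$, $\bar z>0$; $\theta_1(0,t)=\theta_c$, $\theta_2(1,t)=0$, $\theta_3(0,t)=\pi/2$, $-\theta_1(1,t)+\theta_3(1,t)=\beta$, $\theta_2(0,t)-\theta_3(1,t)=-\pi+\beta$; $H_1(1,t)=H_2(0,t)$; $H_{1\alpha}(0,t)=0$, $H_{2\alpha}(1,t)=0$, and $\frac{H_{1\alpha}}{\sqrt{r_{1\alpha}^2+z_{1\alpha}^2}}\Big|_{(1,t)}=\frac{H_{2\alpha}}{\sqrt{r_{2\alpha}^2+z_{2\alpha}^2}}\Big|_{(0,t)}$. Constraints: $0<r_1,r_3<1$ on $[0,1]$, $0<r_2<1$ on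 $[0,1)$, $z_1,z_3>0$ on $(0,1]$, $z_2>0$ on $[0,1]$ (for all $t$); the curves do not self-intersect, and distinct curves meet only at $(\bar r,\bar z)$. **Energy.** $\mathbb E(t)=\gamma_{gas}A_{gas}(t)+\gamma_{grs}A_{grs}(t)+\gamma_{ex}A_{ex}(t)+\gamma_{gb}A_{gb}(t)$, where $A_{gas}=\pi (r_1^* )^2$, $A_{grs}=\pi-\pi (r_1^* )^2$, $A_{ex}=2\pi\sum_{i=1,2}\int_0^1r_i\sqrt{r_{i\alpha}^2+z_{i\alpha}^2}\,d\alpha$, $A_{gb}=2\pi\int_0^1r_3\sqrt{r_{3\alpha}^2+z_{3\alpha}^2}\,d\alpha$. Equivalently $\mathbb E=\pi\gamma_{grs}+\gamma_{ex}(A_{ex}+\cos(\theta_c)\pi (r_1^* )^2)+\gamma_{gb}A_{gb}$. *)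

(* Defs.v *)
(* Coupled surface diffusion / motion by mean curvature of three
   axisymmetric surfaces, over Stdlib's real numbers and Coquelicot. *)
From Stdlib Require Import Reals.
From Coquelicot Require Import Coquelicot.
Open Scope R_scope.

(* Partial derivatives in the parameter (first argument) and in time. *)
Definition Da (f : R -> R -> R) (a t : R) : R := Derive (fun u => f u t) a.
Definition Dt (f : R -> R -> R) (a t : R) : R := Derive (fun s => f a s) t.

Definition unit_slab (T a t : R) : Prop := 0 <= a <= 1 /\ 0 <= t < T.

(* Smoothness up to the boundary of [0,1] x [0,T): [f] is C^infinity on an open
   neighbourhood of this set.  Hence at boundary points the two-sided
   derivatives [Da] and [Dt] (and their iterates) are determined by the values
   of [f] on the set itself. *)
Definition smooth_on_slab (T : R) (f : R -> R -> R) : Prop :=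
  forall a t, unit_slab T a t ->
    locally_2d (fun u s => forall n : nat, ex_diff_n f n u s) a t.

Record moving_curve := MovingCurve {
  r : R -> R -> R;
  z : R -> R -> R;
  theta : R -> R -> R
}.

Definition speed (G : moving_curve) (a t : R) : R :=
  sqrt (Da (r G) a t ^ 2 + Da (z G) a t ^ 2).

Definition H (G : moving_curve) (a t : R) : R :=
  (Da (r G) a t * Da (Da (z G)) a t - Da (z G) a t * Da (Da (r G)) a t)
    / (2 * speed G a t ^ 3)
  + Da (z G) a t / (2 * r G a t * speed G a t).

Record regular_curve (T : R) (G : moving_curve) : Prop := {
  smooth_r : smooth_on_slab T (r G);
  smooth_z : smooth_on_slab T (z G);
  immersed : forall a t, unit_slab T a t ->
    0 < Da (r G) a t ^ 2 + Da (z G) a t ^ 2;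
  uniform_parameter : forall a t, unit_slab T a t ->
    Da (r G) a t * Da (Da (r G)) a t + Da (z G) a t * Da (Da (z G)) a t = 0;
  theta_continuous :
    continuous_on (fun p : R * R => unit_slab T (fst p) (snd p))
                  (fun p : R * R => theta G (fst p) (snd p));
  theta_range : forall a t, unit_slab T a t -> - PI < theta G a t <= PI;
  theta_cos : forall a t, unit_slab T a t ->
    Da (r G) a t / speed G a t = cos (theta G a t);
  theta_sin : forall a t, unit_slab T a t ->
    Da (z G) a t / speed G a t = sin (theta G a t)
}.

Definition surface_diffusion (B T : R) (G : moving_curve) : Prop :=
  forall a t, 0 < a < 1 -> 0 < t < T ->
    Da (r G) a t * Dt (z G) a t - Da (z G) a t * Dt (r G) a t
    = - B * Da (fun u s => r G u s * Da (H G) u s) a t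
      / (r G a t * speed G a t).

Definition mean_curvature_motion (A T : R) (G : moving_curve) : Prop :=
  forall a t, 0 < a < 1 -> 0 < t < T ->
    Da (r G) a t * Dt (z G) a t - Da (z G) a t * Dt (r G) a t
    = A * speed G a t * H G a t.

(* G1, G2: the two parts of the exterior surface; G3: the grain boundary;
   r1s, r3s, z2s: the endpoint coordinates r_1^*, r_3^*, z_2^*;
   (rbar, zbar): the triple junction. *)
Record configuration := Configuration {
  G1 : moving_curve;
  G2 : moving_curve;
  G3 : moving_curve;
  r1s : R -> R;
  r3s : R -> R;
  z2s : R -> R;
  rbar : R -> R;
  zbar : R -> R
}.

Definition beta (gex ggb : R) : R := acos (- ggb / (2 * gex)).
Definition theta_c (gex ggas ggrs : R) : R := acos ((ggas - ggrs) / gex).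

Definition point (G : moving_curve) (a t : R) : R * R := (r G a t, z G a t).

Record boundary_conditions (gex ggb ggas ggrs t : R) (C : configuration)
  : Prop := {
  G1_start : point (G1 C) 0 t = (r1s C t, 0);
  G1_end : point (G1 C) 1 t = (rbar C t, zbar C t);
  G2_start : point (G2 C) 0 t = (rbar C t, zbar C t);
  G3_end : point (G3 C) 1 t = (rbar C t, zbar C t);
  G2_end : point (G2 C) 1 t = (1, z2s C t);
  G3_start : point (G3 C) 0 t = (r3s C t, 0);
  r1s_pos : 0 < r1s C t;
  r1s_lt_r3s : r1s C t < r3s C t;
  r3s_lt_1 : r3s C t < 1;
  z2s_pos : 0 < z2s C t;
  rbar_range : 0 < rbar C t < 1;
  zbar_pos : 0 < zbar C t;
  contact_angle : theta (G1 C) 0 t = theta_c gex ggas ggrs;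
  theta2_end : theta (G2 C) 1 t = 0;
  theta3_start : theta (G3 C) 0 t = PI / 2;
  junction_angle_13 : - theta (G1 C) 1 t + theta (G3 C) 1 t = beta gex ggb;
  junction_angle_23 :
    theta (G2 C) 0 t - theta (G3 C) 1 t = - PI + beta gex ggb;
  chemical_potential : H (G1 C) 1 t = H (G2 C) 0 t;
  no_flux_1 : Da (H (G1 C)) 0 t = 0;
  no_flux_2 : Da (H (G2 C)) 1 t = 0;
  flux_balance :
    Da (H (G1 C)) 1 t / speed (G1 C) 1 t = Da (H (G2 C)) 0 t / speed (G2 C) 0 t
}.

Definition simple_arc (G : moving_curve) (t : R) : Prop :=
  forall a b, 0 <= a <= 1 -> 0 <= b <= 1 ->
    point G a t = point G b t -> a = b.

Definition meet_only_at (p : R * R) (G G' : moving_curve) (t : R) : Prop :=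
  forall a b, 0 <= a <= 1 -> 0 <= b <= 1 ->
    point G a t = point G' b t -> point G a t = p.

Record geometric_constraints (t : R) (C : configuration) : Prop := {
  r1_range : forall a, 0 <= a <= 1 -> 0 < r (G1 C) a t < 1;
  r3_range : forall a, 0 <= a <= 1 -> 0 < r (G3 C) a t < 1;
  r2_range : forall a, 0 <= a < 1 -> 0 < r (G2 C) a t < 1;
  z1_pos : forall a, 0 < a <= 1 -> 0 < z (G1 C) a t;
  z3_pos : forall a, 0 < a <= 1 -> 0 < z (G3 C) a t;
  z2_pos : forall a, 0 <= a <= 1 -> 0 < z (G2 C) a t;
  G1_simple : simple_arc (G1 C) t;
  G2_simple : simple_arc (G2 C) t;
  G3_simple : simple_arc (G3 C) t;
  G1_G2_meet : meet_only_at (rbar C t, zbar C t) (G1 C) (G2 C) t;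
  G1_G3_meet : meet_only_at (rbar C t, zbar C t) (G1 C) (G3 C) t;
  G2_G3_meet : meet_only_at (rbar C t, zbar C t) (G2 C) (G3 C) t
}.

Record solution (A B gex ggb ggas ggrs T : R) (C : configuration) : Prop := {
  regular_1 : regular_curve T (G1 C);
  regular_2 : regular_curve T (G2 C);
  regular_3 : regular_curve T (G3 C);
  motion_1 : surface_diffusion B T (G1 C);
  motion_2 : surface_diffusion B T (G2 C);
  motion_3 : mean_curvature_motion A T (G3 C);
  boundary : forall t, 0 <= t < T -> boundary_conditions gex ggb ggas ggrs t C;
  constraints : forall t, 0 <= t < T -> geometric_constraints t C
}.

Definition surface_area (G : moving_curve) (t : R) : R :=
  2 * PI * RInt (fun a => r G a t * speed G a t) 0 1.

Definition A_gas (C : configuration) (t : R) : R := PI * r1s C t ^ 2.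
Definition A_grs (C : configuration) (t : R) : R := PI - PI * r1s C t ^ 2.
Definition A_ex (C : configuration) (t : R) : R :=
  surface_area (G1 C) t + surface_area (G2 C) t.
Definition A_gb (C : configuration) (t : R) : R := surface_area (G3 C) t.

Definition energy (gex ggb ggas ggrs : R) (C : configuration) (t : R) : R :=
  ggas * A_gas C t + ggrs * A_grs C t + gex * A_ex C t + ggb * A_gb C t.

(* Main.v *)
Require Import Defs.
From Stdlib Require Import Reals Lra Classical ClassicalEpsilon.
From Coquelicot Require Import Coquelicot.
Open Scope R_scope.

(** Write [V = r_a z_t - z_a r_t] for the normal motion of a curve and [s] for
    its speed.  The first variation of the area of a surface of revolution is
    the pointwise identity
      [(r s)_t = (r (r_a r_t + z_a z_t) / s)_a - 2 r H V]
    (lemma [Dt_area_density]), so that the area changes only through the two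
    endpoints, by the motion along the conormal, and through the bulk term
    [- 2 r H V] (lemma [is_derive_surface_area]).

    The bulk term dissipates.  Under mean curvature motion it is
    [- 2 A r s H^2 <= 0].  Under surface diffusion [- 2 r H V] equals
    [2 B H (r H_a)_a / s = 2 B ((r H H_a / s)_a - r H_a^2 / s)], because the
    speed is constant along the curve; the fluxes [r H H_a / s] vanish at the
    two outer ends of the exterior surface and cancel at the triple junction,
    which leaves [- 2 B r H_a^2 / s <= 0].

    The boundary terms cancel against each other (lemma [boundary_work]).
    At the contact line Young's law [gex cos theta_c = ggas - ggrs] balances
    the change of the substrate areas; at the triple junction the angle
    conditions say that the three tensions [gex], [gex], [ggb] are in
    equilibrium; at the two remaining ends the curve meets a fixed line
    orthogonally.

    Hence the energy has a nonpositive derivative for [0 < t < T], and it is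
    differentiable on [0 <= t < T], so the mean value theorem concludes. *)

(** * Functions smooth near a point *)

(** Asking for all orders of differentiability on one common neighbourhood makes
    the property open, and each partial derivative inherits it;
    [smooth_on_slab T f] says that it holds at every point of the slab. *)
Definition smooth_at (f : R -> R -> R) (a t : R) : Prop :=
  locally_2d (fun u s => forall n : nat, ex_diff_n f n u s) a t.

Lemma smooth_at_Da f a t : smooth_at f a t -> smooth_at (Da f) a t.
Proof.
  apply locally_2d_impl, locally_2d_forall; intros u s Hf n.
  exact (proj1 (proj2 (proj2 (proj2 (Hf (S n)))))).
Qed.

Lemma smooth_at_Dt f a t : smooth_at f a t -> smooth_at (Dt f) a t.
Proof.
  apply locally_2d_impl, locally_2d_forall; intros u s Hf n.
  exact (proj2 (proj2 (proj2 (proj2 (Hf (S n)))))).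
Qed.

Lemma smooth_at_continuity f a t : smooth_at f a t -> continuity_2d_pt f a t.
Proof. intros Hf; exact (proj1 (locally_2d_singleton _ _ _ Hf O)). Qed.

Lemma smooth_at_is_derive_a f a t :
  smooth_at f a t -> is_derive (fun u => f u t) a (Da f a t).
Proof.
  intros Hf; apply Derive_correct.
  exact (proj1 (proj2 (locally_2d_singleton _ _ _ Hf 1%nat))).
Qed.

Lemma smooth_at_is_derive_t f a t :
  smooth_at f a t -> is_derive (fun s => f a s) t (Dt f a t).
Proof.
  intros Hf; apply Derive_correct.
  exact (proj1 (proj2 (proj2 (locally_2d_singleton _ _ _ Hf 1%nat)))).
Qed.

Lemma smooth_at_open f a t :
  smooth_at f a t -> locally_2d (smooth_at f) a t.
Proof.
  apply locally_2d_impl_strong, locally_2d_forall; intros u s Hf; exact Hf.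
Qed.

Lemma smooth_at_Dt_Da f a t :
  smooth_at f a t -> Dt (Da f) a t = Da (Dt f) a t.
Proof.
  intros Hf; symmetry.
  apply (Schwarz f a t).
  - apply locally_2d_impl with (2 := smooth_at_open _ _ _ Hf).
    apply locally_2d_forall; intros u s Hus.
    repeat split; eexists.
    + exact (smooth_at_is_derive_a _ _ _ Hus).
    + exact (smooth_at_is_derive_t _ _ _ Hus).
    + exact (smooth_at_is_derive_a _ _ _ (smooth_at_Dt _ _ _ Hus)).
    + exact (smooth_at_is_derive_t _ _ _ (smooth_at_Da _ _ _ Hus)).
  - exact (smooth_at_continuity _ _ _ (smooth_at_Da _ _ _ (smooth_at_Dt _ _ _ Hf))).
  - exact (smooth_at_continuity _ _ _ (smooth_at_Dt _ _ _ (smooth_at_Da _ _ _ Hf))).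
Qed.

Definition has_partials (f fa ft : R -> R -> R) (a t : R) : Prop :=
  locally_2d (fun u s => is_derive (fun v => f v s) u (fa u s)
                      /\ is_derive (fun v => f u v) s (ft u s)) a t.

(** The partial derivatives only have to be known as functions near the point,
    which is what differentiating a quotient or a root requires. *)
Lemma ex_diff_n_step (f fa ft : R -> R -> R) n a t :
  continuity_2d_pt f a t ->
  has_partials f fa ft a t ->
  ex_diff_n fa n a t -> ex_diff_n ft n a t -> ex_diff_n f (S n) a t.
Proof.
  intros Hc Hd Ha Ht.
  destruct (locally_2d_singleton _ _ _ Hd) as [Hda Hdt].
  repeat split; [exact Hc | eexists; exact Hda | eexists; exact Hdt | |].
  - apply ex_diff_n_ext_loc with (2 := Ha).
    apply locally_2d_impl with (2 := Hd), locally_2d_forall.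
    intros u s [Hu _]; symmetry; apply is_derive_unique, Hu.
  - apply ex_diff_n_ext_loc with (2 := Ht).
    apply locally_2d_impl with (2 := Hd), locally_2d_forall.
    intros u s [_ Hs]; symmetry; apply is_derive_unique, Hs.
Qed.

Lemma locally_2d_mono (P Q : R -> R -> Prop) a t :
  (forall u s, P u s -> Q u s) -> locally_2d P a t -> locally_2d Q a t.
Proof. intros HPQ; apply locally_2d_impl, locally_2d_forall, HPQ. Qed.

(** That sums, products, inverses and square roots of smooth functions are again
    smooth is proved for all operations at once: the expressions built from
    smooth functions are continuous and their partial derivatives are again
    such expressions, so an induction on the order of differentiability applies
    to the whole class, whereas a class closed under one operation only is not
    closed under differentiation. *)
Inductive smooth_expr (a t : R) : (R -> R -> R) -> Prop :=
| expr_smooth f : smooth_at f a t -> smooth_expr a t f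
| expr_const c : smooth_expr a t (fun _ _ => c)
| expr_plus f g : smooth_expr a t f -> smooth_expr a t g ->
    smooth_expr a t (fun u s => f u s + g u s)
| expr_mult f g : smooth_expr a t f -> smooth_expr a t g ->
    smooth_expr a t (fun u s => f u s * g u s)
| expr_inv f : smooth_expr a t f -> f a t <> 0 ->
    smooth_expr a t (fun u s => / f u s)
| expr_sqrt f : smooth_expr a t f -> 0 < f a t ->
    smooth_expr a t (fun u s => sqrt (f u s)).

Lemma smooth_expr_continuity f a t :
  smooth_expr a t f -> continuity_2d_pt f a t.
Proof.
  induction 1 as [f Hf | c | f g _ IHf _ IHg | f g _ IHf _ IHg | f _ IH Hf | f _ IH Hf].
  - exact (smooth_at_continuity _ _ _ Hf).
  - apply continuity_2d_pt_const.
  - apply continuity_2d_pt_plus; assumption.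
  - apply continuity_2d_pt_mult; assumption.
  - apply continuity_2d_pt_inv; assumption.
  - apply continuity_1d_2d_pt_comp; [apply continuity_pt_sqrt; lra | exact IH].
Qed.

Lemma continuity_2d_pt_pos f a t :
  continuity_2d_pt f a t -> 0 < f a t -> locally_2d (fun u s => 0 < f u s) a t.
Proof.
  intros Hc Hf; destruct (Hc (mkposreal _ Hf)) as [d Hd]; exists d.
  intros u s Hu Hs; specialize (Hd u s Hu Hs); simpl in Hd.
  apply Rabs_def2 in Hd; lra.
Qed.

Lemma smooth_expr_open f a t :
  smooth_expr a t f -> locally_2d (fun u s => smooth_expr u s f) a t.
Proof.
  induction 1 as [f Hf | c | f g _ IHf _ IHg | f g _ IHf _ IHg | f Ef IH Hf | f Ef IH Hf].
  - generalize (smooth_at_open _ _ _ Hf).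
    apply locally_2d_mono; intros u s; apply expr_smooth.
  - apply locally_2d_forall; intros u s; apply expr_const.
  - generalize (locally_2d_and _ _ _ _ IHf IHg).
    apply locally_2d_mono; intros u s []; apply expr_plus; assumption.
  - generalize (locally_2d_and _ _ _ _ IHf IHg).
    apply locally_2d_mono; intros u s []; apply expr_mult; assumption.
  - generalize (locally_2d_and _ _ _ _ IH
      (continuity_2d_pt_neq_0 _ _ _ (smooth_expr_continuity _ _ _ Ef) Hf)).
    apply locally_2d_mono; intros u s []; apply expr_inv; assumption.
  - generalize (locally_2d_and _ _ _ _ IH
      (continuity_2d_pt_pos _ _ _ (smooth_expr_continuity _ _ _ Ef) Hf)).
    apply locally_2d_mono; intros u s []; apply expr_sqrt; assumption.
Qed.

Lemma smooth_expr_partials f a t :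
  smooth_expr a t f ->
  exists fa ft, smooth_expr a t fa /\ smooth_expr a t ft /\ has_partials f fa ft a t.
Proof.
  induction 1 as [f Hf | c | f g _ [fa [ft [Ha [Ht Hp]]]] _ [ga [gt [Ka [Kt Kp]]]]
    | f g Ef [fa [ft [Ha [Ht Hp]]]] Eg [ga [gt [Ka [Kt Kp]]]]
    | f Ef [fa [ft [Ha [Ht Hp]]]] Hf | f Ef [fa [ft [Ha [Ht Hp]]]] Hf].
  - exists (Da f), (Dt f); repeat split.
    + apply expr_smooth, smooth_at_Da, Hf.
    + apply expr_smooth, smooth_at_Dt, Hf.
    + generalize (smooth_at_open _ _ _ Hf); apply locally_2d_mono; intros u s Hus.
      split; [apply smooth_at_is_derive_a | apply smooth_at_is_derive_t]; exact Hus.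
  - exists (fun _ _ => 0), (fun _ _ => 0); repeat split; try apply expr_const.
    apply locally_2d_forall; split; exact (is_derive_const _ _).
  - exists (fun u s => fa u s + ga u s), (fun u s => ft u s + gt u s).
    repeat split; try (apply expr_plus; assumption).
    generalize (locally_2d_and _ _ _ _ Hp Kp); apply locally_2d_mono.
    intros u s [[Hu Hs] [Ku Ks]].
    split; [exact (is_derive_plus _ _ _ _ _ Hu Ku) | exact (is_derive_plus _ _ _ _ _ Hs Ks)].
  - exists (fun u s => fa u s * g u s + f u s * ga u s),
      (fun u s => ft u s * g u s + f u s * gt u s).
    repeat split; try (apply expr_plus; apply expr_mult; assumption).
    generalize (locally_2d_and _ _ _ _ Hp Kp); apply locally_2d_mono.
    intros u s [[Hu Hs] [Ku Ks]]; split.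
    + exact (is_derive_mult _ _ _ _ _ Hu Ku Rmult_comm).
    + exact (is_derive_mult _ _ _ _ _ Hs Ks Rmult_comm).
  - exists (fun u s => -1 * fa u s * (/ f u s * / f u s)),
      (fun u s => -1 * ft u s * (/ f u s * / f u s)).
    repeat split; try (repeat apply expr_mult; first [apply expr_const
      | apply expr_inv; assumption | assumption]).
    generalize (locally_2d_and _ _ _ _ Hp
      (continuity_2d_pt_neq_0 _ _ _ (smooth_expr_continuity _ _ _ Ef) Hf)).
    apply locally_2d_mono; intros u s [[Hu Hs] Hn]; split.
    + replace (-1 * fa u s * (/ f u s * / f u s)) with (- fa u s / f u s ^ 2)
        by (field; exact Hn).
      exact (is_derive_inv _ _ _ Hu Hn).
    + replace (-1 * ft u s * (/ f u s * / f u s)) with (- ft u s / f u s ^ 2)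
        by (field; exact Hn).
      exact (is_derive_inv _ _ _ Hs Hn).
  - assert (Hs : 2 * sqrt (f a t) <> 0) by (generalize (sqrt_lt_R0 _ Hf); lra).
    assert (Es : smooth_expr a t (fun u s => / (2 * sqrt (f u s)))).
    { apply (expr_inv _ _ (fun u s => 2 * sqrt (f u s))); [|exact Hs].
      apply (expr_mult _ _ (fun _ _ => 2)); [apply expr_const|].
      apply expr_sqrt; assumption. }
    exists (fun u s => fa u s * / (2 * sqrt (f u s))),
      (fun u s => ft u s * / (2 * sqrt (f u s))).
    repeat split; try (apply (expr_mult _ _ _ (fun u s => / (2 * sqrt (f u s)))); assumption).
    generalize (locally_2d_and _ _ _ _ Hp
      (continuity_2d_pt_pos _ _ _ (smooth_expr_continuity _ _ _ Ef) Hf)).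
    apply locally_2d_mono; intros u s [[Hu Hv] Hn]; split.
    + exact (is_derive_sqrt _ _ _ Hu Hn).
    + exact (is_derive_sqrt _ _ _ Hv Hn).
Qed.

Lemma smooth_expr_ex_diff_n n f a t : smooth_expr a t f -> ex_diff_n f n a t.
Proof.
  revert f; induction n as [|n IH]; intros f Ef;
    pose proof (smooth_expr_continuity _ _ _ Ef) as Hc.
  - split; [exact Hc | exact I].
  - destruct (smooth_expr_partials _ _ _ Ef) as [fa [ft [Ea [Et Hp]]]].
    exact (ex_diff_n_step f fa ft n a t Hc Hp (IH _ Ea) (IH _ Et)).
Qed.

Lemma smooth_at_of_expr f a t : smooth_expr a t f -> smooth_at f a t.
Proof.
  intros Ef; generalize (smooth_expr_open _ _ _ Ef); apply locally_2d_mono.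
  intros u s Es n; apply smooth_expr_ex_diff_n, Es.
Qed.

Lemma smooth_at_const c a t : smooth_at (fun _ _ => c) a t.
Proof. apply smooth_at_of_expr, expr_const. Qed.

Lemma smooth_at_plus f g a t : smooth_at f a t -> smooth_at g a t ->
  smooth_at (fun u s => f u s + g u s) a t.
Proof. intros; apply smooth_at_of_expr, expr_plus; apply expr_smooth; assumption. Qed.

Lemma smooth_at_mult f g a t : smooth_at f a t -> smooth_at g a t ->
  smooth_at (fun u s => f u s * g u s) a t.
Proof. intros; apply smooth_at_of_expr, expr_mult; apply expr_smooth; assumption. Qed.

Lemma smooth_at_inv f a t : smooth_at f a t -> f a t <> 0 ->
  smooth_at (fun u s => / f u s) a t.
Proof. intros; apply smooth_at_of_expr, expr_inv; [apply expr_smooth|]; assumption. Qed.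

Lemma smooth_at_sqrt f a t : smooth_at f a t -> 0 < f a t ->
  smooth_at (fun u s => sqrt (f u s)) a t.
Proof. intros; apply smooth_at_of_expr, expr_sqrt; [apply expr_smooth|]; assumption. Qed.

Lemma smooth_at_pow f n a t : smooth_at f a t -> smooth_at (fun u s => f u s ^ n) a t.
Proof.
  intros Hf; induction n as [|n IH]; [exact (smooth_at_const 1 a t)|].
  exact (smooth_at_mult _ _ _ _ Hf IH).
Qed.

Lemma smooth_at_minus f g a t : smooth_at f a t -> smooth_at g a t ->
  smooth_at (fun u s => f u s - g u s) a t.
Proof.
  intros Hf Hg.
  assert (Hm : smooth_at (fun u s => f u s + -1 * g u s) a t)
    by exact (smooth_at_plus _ _ _ _ Hf (smooth_at_mult _ _ _ _ (smooth_at_const (-1) a t) Hg)).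
  revert Hm; apply locally_2d_mono; intros u s Hus n.
  refine (ex_diff_n_ext_loc _ _ _ _ _ _ (Hus n)).
  apply locally_2d_forall; intros; ring.
Qed.

Lemma smooth_at_div f g a t : smooth_at f a t -> smooth_at g a t -> g a t <> 0 ->
  smooth_at (fun u s => f u s / g u s) a t.
Proof.
  intros Hf Hg Hn; exact (smooth_at_mult _ _ _ _ Hf (smooth_at_inv _ _ _ Hg Hn)).
Qed.

(** * Integrals of smooth functions over the parameter interval *)

(** Compactness of the interval turns neighbourhoods of the points [(u, t)] into
    one time interval that serves all [u]; this is needed at [t = 0], where the
    slab itself is not a neighbourhood. *)
Lemma tube (P : R -> R -> Prop) (a b t : R) :
  (forall u, a <= u <= b -> locally_2d P u t) ->
  locally t (fun s => forall u, a <= u <= b -> P u s).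
Proof.
  intros HP.
  assert (Hd : forall u, exists d : posreal, a <= u <= b ->
     forall v s, Rabs (v - u) < d -> Rabs (s - t) < d -> P v s).
  { intros u; destruct (classic (a <= u <= b)) as [Hu|Hu].
    - destruct (HP u Hu) as [d Hd]; exists d; intros _; exact Hd.
    - exists (mkposreal 1 Rlt_0_1); intros Hu'; contradiction. }
  destruct (choice _ Hd) as [delta Hdelta].
  destruct (compactness_value_1d a b delta) as [d Hcomp].
  exists d; intros s Hs u Hu.
  apply NNPP; intros HnP.
  apply (Hcomp u Hu); intros [v [Hv [Huv Hdv]]].
  apply HnP, (Hdelta v Hv); [exact Huv|].
  apply Rlt_le_trans with (1 := Hs); exact Hdv.
Qed.

Lemma smooth_at_slice_continuous f a t :
  smooth_at f a t -> continuous (fun u => f u t) a.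
Proof.
  intros Hf; apply (ex_derive_continuous (fun u => f u t)); eexists.
  exact (smooth_at_is_derive_a _ _ _ Hf).
Qed.

Lemma ex_RInt_smooth f t : (forall a, 0 <= a <= 1 -> smooth_at f a t) ->
  ex_RInt (fun a => f a t) 0 1.
Proof.
  intros Hf; apply (ex_RInt_continuous (V := R_CompleteNormedModule)); intros a.
  rewrite Rmin_left, Rmax_right by lra; intros Ha.
  exact (smooth_at_slice_continuous _ _ _ (Hf a Ha)).
Qed.

Lemma is_derive_RInt_smooth f t : (forall a, 0 <= a <= 1 -> smooth_at f a t) ->
  is_derive (fun s => RInt (fun a => f a s) 0 1) t (RInt (fun a => Dt f a t) 0 1).
Proof.
  intros Hf.
  assert (Hloc : locally t (fun s => forall a, 0 <= a <= 1 -> smooth_at f a s))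
    by (apply tube; intros a Ha; exact (smooth_at_open _ _ _ (Hf a Ha))).
  apply (is_derive_RInt_param (fun s a => f a s)); rewrite ?Rmin_left, ?Rmax_right by lra.
  - revert Hloc; apply filter_imp; intros s Hs a Ha; eexists.
    exact (smooth_at_is_derive_t _ _ _ (Hs a Ha)).
  - intros a Ha.
    pose proof (smooth_at_continuity _ _ _ (smooth_at_Dt _ _ _ (Hf a Ha))) as Hc.
    intros eps; destruct (Hc eps) as [d Hd]; exists d; intros u v Hu Hv.
    exact (Hd v u Hv Hu).
  - revert Hloc; apply filter_imp; intros s Hs; exact (ex_RInt_smooth _ _ Hs).
Qed.

Lemma RInt_Da f t : (forall a, 0 <= a <= 1 -> smooth_at f a t) ->
  RInt (fun a => Da f a t) 0 1 = f 1 t - f 0 t.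
Proof.
  intros Hf; apply is_RInt_unique.
  apply (is_RInt_derive (fun a => f a t) (fun a => Da f a t));
    intros a; rewrite Rmin_left, Rmax_right by lra; intros Ha.
  - exact (smooth_at_is_derive_a _ _ _ (Hf a Ha)).
  - exact (smooth_at_slice_continuous _ _ _ (smooth_at_Da _ _ _ (Hf a Ha))).
Qed.

(** * Evolution of the area of one curve *)

Definition positive_radius (T : R) (G : moving_curve) : Prop :=
  forall a t, unit_slab T a t -> 0 < r G a t.

Definition area_density (G : moving_curve) (a t : R) : R := r G a t * speed G a t.

(** [r] times the component of the velocity along the curve: the rate at which
    an endpoint that moves along the curve creates area, up to [2 PI]. *)
Definition tangential_flux (G : moving_curve) (a t : R) : R :=
  r G a t * (Da (r G) a t * Dt (r G) a t + Da (z G) a t * Dt (z G) a t) / speed G a t.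

Definition normal_motion (G : moving_curve) (a t : R) : R :=
  Da (r G) a t * Dt (z G) a t - Da (z G) a t * Dt (r G) a t.

(** The normal velocity is [normal_motion / speed] and [2 H] is the sum of the
    principal curvatures, so this is the area lost in the interior per unit of
    parameter and time, up to [2 PI]. *)
Definition area_loss (G : moving_curve) (a t : R) : R :=
  2 * r G a t * H G a t * normal_motion G a t.

(** The mean curvature is the chemical potential of surface diffusion; this is
    the flux term left by integrating [H (r H_a)_a / speed] by parts. *)
Definition chemical_flux (G : moving_curve) (a t : R) : R :=
  r G a t * H G a t * Da (H G) a t / speed G a t.

Section Curve.
Variables (T : R) (G : moving_curve).
Hypothesis reg : regular_curve T G.
Hypothesis pos : positive_radius T G.

Lemma speed_pos a t : unit_slab T a t -> 0 < speed G a t.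
Proof. intros Hat; apply sqrt_lt_R0, (immersed _ _ reg _ _ Hat). Qed.

Lemma smooth_speed a t : unit_slab T a t -> smooth_at (speed G) a t.
Proof.
  intros Hat.
  apply (smooth_at_sqrt (fun u s => Da (r G) u s ^ 2 + Da (z G) u s ^ 2)).
  - apply smooth_at_plus; apply smooth_at_pow, smooth_at_Da.
    + exact (smooth_r _ _ reg _ _ Hat).
    + exact (smooth_z _ _ reg _ _ Hat).
  - exact (immersed _ _ reg _ _ Hat).
Qed.

Ltac smooth Hat :=
  lazymatch goal with
  | |- smooth_at (fun u s => @?f u s + @?g u s) _ _ =>
      apply (smooth_at_plus f g); smooth Hat
  | |- smooth_at (fun u s => @?f u s - @?g u s) _ _ =>
      apply (smooth_at_minus f g); smooth Hat
  | |- smooth_at (fun u s => @?f u s * @?g u s) _ _ =>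
      apply (smooth_at_mult f g); smooth Hat
  | |- smooth_at (fun u s => @?f u s / @?g u s) _ _ =>
      apply (smooth_at_div f g); [smooth Hat | smooth Hat | ]
  | |- smooth_at (fun u s => @?f u s ^ ?n) _ _ =>
      apply (smooth_at_pow f n); smooth Hat
  | |- smooth_at (fun _ _ => ?c) _ _ => apply (smooth_at_const c)
  | |- smooth_at (fun u s => Da ?f u s) _ _ => apply (smooth_at_Da f); smooth Hat
  | |- smooth_at (fun u s => Dt ?f u s) _ _ => apply (smooth_at_Dt f); smooth Hat
  | |- smooth_at (Da ?f) _ _ => apply (smooth_at_Da f); smooth Hat
  | |- smooth_at (Dt ?f) _ _ => apply (smooth_at_Dt f); smooth Hat
  | _ => first [ exact (smooth_r _ _ reg _ _ Hat) | exact (smooth_z _ _ reg _ _ Hat)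
               | exact (smooth_speed _ _ Hat) | idtac ]
  end.

Lemma smooth_H a t : unit_slab T a t -> smooth_at (H G) a t.
Proof.
  intros Hat; pose proof (speed_pos _ _ Hat) as Hs; pose proof (pos _ _ Hat) as Hr.
  unfold H; smooth Hat.
  - apply Rgt_not_eq, Rmult_lt_0_compat; [lra | apply pow_lt; assumption].
  - apply Rgt_not_eq; repeat apply Rmult_lt_0_compat; lra.
Qed.

Lemma smooth_area_density a t : unit_slab T a t -> smooth_at (area_density G) a t.
Proof. intros Hat; unfold area_density; smooth Hat. Qed.

Lemma smooth_tangential_flux a t : unit_slab T a t -> smooth_at (tangential_flux G) a t.
Proof.
  intros Hat; unfold tangential_flux; smooth Hat.
  apply Rgt_not_eq, speed_pos, Hat.
Qed.

Lemma smooth_area_loss a t : unit_slab T a t -> smooth_at (area_loss G) a t.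
Proof.
  intros Hat; unfold area_loss, normal_motion; smooth Hat.
  exact (smooth_H _ _ Hat).
Qed.

Lemma smooth_chemical_flux a t : unit_slab T a t -> smooth_at (chemical_flux G) a t.
Proof.
  intros Hat; unfold chemical_flux; smooth Hat.
  1, 2: exact (smooth_H _ _ Hat).
  apply Rgt_not_eq, speed_pos, Hat.
Qed.

Lemma speed_sqr a t :
  speed G a t ^ 2 = Da (r G) a t ^ 2 + Da (z G) a t ^ 2.
Proof.
  unfold speed; rewrite pow2_sqrt; [reflexivity|].
  generalize (pow2_ge_0 (Da (r G) a t)) (pow2_ge_0 (Da (z G) a t)); lra.
Qed.

(** The parameter is proportional to arc length at each time. *)
Lemma Da_speed a t : unit_slab T a t -> Da (speed G) a t = 0.
Proof.
  intros Hat; pose proof (speed_pos _ _ Hat) as Hpos.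
  pose proof (smooth_at_is_derive_a _ _ _ (smooth_at_Da _ _ _ (smooth_r _ _ reg _ _ Hat))) as Hr.
  pose proof (smooth_at_is_derive_a _ _ _ (smooth_at_Da _ _ _ (smooth_z _ _ reg _ _ Hat))) as Hz.
  apply is_derive_unique.
  pose proof (is_derive_sqrt _ _ _ (is_derive_plus _ _ _ _ _
    (is_derive_pow _ 2 _ _ Hr) (is_derive_pow _ 2 _ _ Hz)) (immersed _ _ reg _ _ Hat)) as Hs.
  change (is_derive (fun u => speed G u t) a) with
    (is_derive (fun u => sqrt (plus (Da (r G) u t ^ 2) (Da (z G) u t ^ 2))) a).
  replace 0 with (plus (INR 2 * Da (Da (r G)) a t * Da (r G) a t ^ Init.Nat.pred 2)
     (INR 2 * Da (Da (z G)) a t * Da (z G) a t ^ Init.Nat.pred 2)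
     / (2 * sqrt (plus (Da (r G) a t ^ 2) (Da (z G) a t ^ 2)))); [exact Hs|].
  pose proof (uniform_parameter _ _ reg _ _ Hat) as Hu.
  unfold plus; simpl INR; simpl Init.Nat.pred; simpl AbelianMonoid.plus.
  replace (_ + _) with (2 * (Da (r G) a t * Da (Da (r G)) a t
    + Da (z G) a t * Da (Da (z G)) a t)) by (simpl; ring).
  rewrite Hu; unfold Rdiv; ring.
Qed.

Lemma Dt_speed a t : unit_slab T a t ->
  Dt (speed G) a t
  = (Da (r G) a t * Da (Dt (r G)) a t + Da (z G) a t * Da (Dt (z G)) a t) / speed G a t.
Proof.
  intros Hat; pose proof (speed_pos _ _ Hat) as Hpos.
  pose proof (smooth_r _ _ reg _ _ Hat) as Sr.
  pose proof (smooth_z _ _ reg _ _ Hat) as Sz.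
  pose proof (smooth_at_is_derive_t _ _ _ (smooth_at_Da _ _ _ Sr)) as Hr.
  pose proof (smooth_at_is_derive_t _ _ _ (smooth_at_Da _ _ _ Sz)) as Hz.
  rewrite (smooth_at_Dt_Da _ _ _ Sr) in Hr; rewrite (smooth_at_Dt_Da _ _ _ Sz) in Hz.
  pose proof (is_derive_sqrt _ _ _ (is_derive_plus _ _ _ _ _
    (is_derive_pow _ 2 _ _ Hr) (is_derive_pow _ 2 _ _ Hz)) (immersed _ _ reg _ _ Hat)) as Hs.
  etransitivity; [exact (is_derive_unique _ _ _ Hs)|]; cbv beta.
  change (sqrt (plus (Da (r G) a t ^ 2) (Da (z G) a t ^ 2))) with (speed G a t).
  unfold plus; simpl; field; lra.
Qed.

(** First variation of area.  The terms with a mixed derivative agree on both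
    sides by Schwarz's theorem; the terms with a second derivative in the
    parameter combine into the curvature because the acceleration of a
    parametrization of constant speed is normal to the curve. *)
Lemma Dt_area_density a t : unit_slab T a t ->
  Dt (area_density G) a t = Da (tangential_flux G) a t - area_loss G a t.
Proof.
  intros Hat; pose proof (speed_pos _ _ Hat) as Hpos; pose proof (pos _ _ Hat) as Hrpos.
  pose proof (smooth_r _ _ reg _ _ Hat) as Sr.
  pose proof (smooth_z _ _ reg _ _ Hat) as Sz.
  pose proof (smooth_speed _ _ Hat) as Ss.
  assert (E1 : Dt (area_density G) a t
     = Dt (r G) a t * speed G a t + r G a t * Dt (speed G) a t).
  { apply is_derive_unique.
    exact (is_derive_mult _ _ _ _ _ (smooth_at_is_derive_t _ _ _ Sr)
      (smooth_at_is_derive_t _ _ _ Ss) Rmult_comm). }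
  assert (E2 : Da (tangential_flux G) a t
     = (Da (r G) a t * (Da (r G) a t * Dt (r G) a t + Da (z G) a t * Dt (z G) a t)
        + r G a t * (Da (Da (r G)) a t * Dt (r G) a t + Da (r G) a t * Da (Dt (r G)) a t
                   + Da (Da (z G)) a t * Dt (z G) a t + Da (z G) a t * Da (Dt (z G)) a t))
       / speed G a t).
  { pose proof (smooth_at_is_derive_a _ _ _ Sr) as H0.
    pose proof (smooth_at_is_derive_a _ _ _ Ss) as H1.
    pose proof (smooth_at_is_derive_a _ _ _ (smooth_at_Da _ _ _ Sr)) as H2.
    pose proof (smooth_at_is_derive_a _ _ _ (smooth_at_Da _ _ _ Sz)) as H3.
    pose proof (smooth_at_is_derive_a _ _ _ (smooth_at_Dt _ _ _ Sr)) as H4.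
    pose proof (smooth_at_is_derive_a _ _ _ (smooth_at_Dt _ _ _ Sz)) as H5.
    rewrite (Da_speed _ _ Hat) in H1.
    apply is_derive_unique.
    evar_last.
    { exact (is_derive_mult _ _ _ _ _ (is_derive_mult _ _ _ _ _ H0 (is_derive_plus _ _ _ _ _
        (is_derive_mult _ _ _ _ _ H2 H4 Rmult_comm)
        (is_derive_mult _ _ _ _ _ H3 H5 Rmult_comm)) Rmult_comm)
        (is_derive_inv _ _ _ H1 (Rgt_not_eq _ _ Hpos)) Rmult_comm). }
    unfold plus, mult; simpl; field; lra. }
  rewrite E1, E2, (Dt_speed _ _ Hat); unfold area_loss, normal_motion, H.
  pose proof (speed_sqr a t) as Hsq.
  pose proof (uniform_parameter _ _ reg _ _ Hat) as Hu.
  set (p := Da (r G) a t) in *; set (q := Da (z G) a t) in *.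
  set (p' := Da (Da (r G)) a t) in *; set (q' := Da (Da (z G)) a t) in *.
  set (s := speed G a t) in *; set (x := r G a t) in *.
  set (rt := Dt (r G) a t); set (zt := Dt (z G) a t).
  (* The acceleration [(p', q')] is orthogonal to the tangent [(p, q)], so it is
     the multiple [(p q' - q p') / s^2] of the normal [(-q, p)]. *)
  assert (K : (p * q' - q * p') * (p * zt - q * rt) = s ^ 2 * (p' * rt + q' * zt)).
  { rewrite Hsq.
    transitivity ((p ^ 2 + q ^ 2) * (p' * rt + q' * zt) - (p * p' + q * q') * (p * rt + q * zt));
      [ring | rewrite Hu; ring]. }
  replace (2 * x * ((p * q' - q * p') / (2 * s ^ 3) + q / (2 * x * s)) * (p * zt - q * rt))
    with (x * ((p * q' - q * p') * (p * zt - q * rt)) / s ^ 3 + q * (p * zt - q * rt) / s)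
    by (field; lra).
  rewrite K.
  replace (rt * s) with (rt * s ^ 2 / s) by (field; lra).
  rewrite Hsq at 1; field; lra.
Qed.

Lemma Da_chemical_flux a t : unit_slab T a t ->
  Da (chemical_flux G) a t
  = H G a t * Da (fun u s => r G u s * Da (H G) u s) a t / speed G a t
    + r G a t * Da (H G) a t ^ 2 / speed G a t.
Proof.
  intros Hat; pose proof (speed_pos _ _ Hat) as Hpos.
  pose proof (smooth_at_is_derive_a _ _ _ (smooth_r _ _ reg _ _ Hat)) as H0.
  pose proof (smooth_at_is_derive_a _ _ _ (smooth_speed _ _ Hat)) as H1.
  pose proof (smooth_at_is_derive_a _ _ _ (smooth_H _ _ Hat)) as H2.
  pose proof (smooth_at_is_derive_a _ _ _ (smooth_at_Da _ _ _ (smooth_H _ _ Hat))) as H3.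
  rewrite (Da_speed _ _ Hat) in H1.
  assert (E : Da (fun u s => r G u s * Da (H G) u s) a t
    = Da (r G) a t * Da (H G) a t + r G a t * Da (Da (H G)) a t)
    by exact (is_derive_unique _ _ _ (is_derive_mult _ _ _ _ _ H0 H3 Rmult_comm)).
  rewrite E.
  apply is_derive_unique.
  evar_last.
  { exact (is_derive_mult _ _ _ _ _ (is_derive_mult _ _ _ _ _
      (is_derive_mult _ _ _ _ _ H0 H2 Rmult_comm) H3 Rmult_comm)
      (is_derive_inv _ _ _ H1 (Rgt_not_eq _ _ Hpos)) Rmult_comm). }
  unfold plus, mult; simpl; field; lra.
Qed.

(** The initial time is included: the energy has to be continuous there, although
    the equations of motion only hold afterwards. *)
Lemma is_derive_surface_area t : 0 <= t < T ->
  is_derive (surface_area G) t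
    (2 * PI * (tangential_flux G 1 t - tangential_flux G 0 t - RInt (fun a => area_loss G a t) 0 1)).
Proof.
  intros Ht.
  assert (Hslab : forall a, 0 <= a <= 1 -> unit_slab T a t) by (split; assumption).
  replace (tangential_flux G 1 t - tangential_flux G 0 t - RInt (fun a => area_loss G a t) 0 1)
    with (RInt (fun a => Dt (area_density G) a t) 0 1).
  - apply (is_derive_scal (fun s => RInt (fun a => area_density G a s) 0 1)).
    apply is_derive_RInt_smooth; intros a Ha; apply smooth_area_density, Hslab, Ha.
  - rewrite <- RInt_Da by (intros a Ha; apply smooth_tangential_flux, Hslab, Ha).
    symmetry.
    etransitivity; [symmetry; apply (RInt_minus (V := R_CompleteNormedModule))|].
    + apply (ex_RInt_smooth (Da (tangential_flux G))).
      intros a Ha; apply smooth_at_Da, smooth_tangential_flux, Hslab, Ha.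
    + apply (ex_RInt_smooth (area_loss G)).
      intros a Ha; apply smooth_area_loss, Hslab, Ha.
    + apply RInt_ext; rewrite Rmin_left, Rmax_right by lra; intros a Ha.
      symmetry; apply Dt_area_density, Hslab; lra.
Qed.

Lemma RInt_area_loss_mean_curvature A t : 0 <= A ->
  mean_curvature_motion A T G -> 0 < t < T ->
  0 <= RInt (fun a => area_loss G a t) 0 1.
Proof.
  intros hA Hm Ht.
  apply RInt_ge_0; [lra | |].
  - apply ex_RInt_smooth; intros a Ha; apply smooth_area_loss; split; lra.
  - intros a Ha; assert (Hat : unit_slab T a t) by (split; lra).
    pose proof (speed_pos _ _ Hat) as Hs; pose proof (pos _ _ Hat) as Hr.
    unfold area_loss, normal_motion; rewrite Hm by assumption.
    replace (2 * r G a t * H G a t * (A * speed G a t * H G a t))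
      with (2 * A * r G a t * speed G a t * H G a t ^ 2) by ring.
    apply Rmult_le_pos; [|apply pow2_ge_0].
    repeat apply Rmult_le_pos; lra.
Qed.

(** Integration by parts of [H (r H_a)_a]: up to the fluxes through the ends, the
    loss is [2 B] times the integral of [r H_a^2 / speed]. *)
Lemma RInt_area_loss_surface_diffusion B t : 0 <= B ->
  surface_diffusion B T G -> 0 < t < T ->
  - 2 * B * (chemical_flux G 1 t - chemical_flux G 0 t)
  <= RInt (fun a => area_loss G a t) 0 1.
Proof.
  intros hB Hm Ht.
  assert (Hslab : forall a, 0 <= a <= 1 -> unit_slab T a t) by (split; lra).
  assert (HF : ex_RInt (fun a => Da (chemical_flux G) a t) 0 1).
  { apply ex_RInt_smooth; intros a Ha; apply smooth_at_Da, smooth_chemical_flux, Hslab, Ha. }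
  rewrite <- RInt_Da by (intros a Ha; apply smooth_chemical_flux, Hslab, Ha).
  change (-2 * B * ?I) with (scal (-2 * B) I).
  rewrite <- (RInt_scal (V := R_CompleteNormedModule)) by exact HF.
  apply RInt_le; [lra | | |].
  - exact (ex_RInt_scal (V := R_NormedModule) _ _ _ _ HF).
  - apply ex_RInt_smooth; intros a Ha; apply smooth_area_loss, Hslab, Ha.
  - intros a Ha; assert (Hat : unit_slab T a t) by (split; lra).
    pose proof (speed_pos _ _ Hat) as Hs; pose proof (pos _ _ Hat) as Hr.
    unfold area_loss, normal_motion; rewrite Hm, Da_chemical_flux by assumption.
    set (W := Da (fun u s => r G u s * Da (H G) u s) a t).
    assert (Hd : 0 <= 2 * B * (r G a t * Da (H G) a t ^ 2 / speed G a t)).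
    { apply Rmult_le_pos; [lra|].
      apply Rdiv_le_0_compat; [|exact Hs].
      apply Rmult_le_pos; [lra | apply pow2_ge_0]. }
    replace (2 * r G a t * H G a t * (- B * W / (r G a t * speed G a t)))
      with (- 2 * B * (H G a t * W / speed G a t)) by (field; lra).
    unfold scal; simpl; unfold mult; simpl; lra.
Qed.

Lemma tangential_flux_polar a t : unit_slab T a t ->
  tangential_flux G a t
  = r G a t * (cos (theta G a t) * Dt (r G) a t + sin (theta G a t) * Dt (z G) a t).
Proof.
  intros Hat; rewrite <- (theta_cos _ _ reg _ _ Hat), <- (theta_sin _ _ reg _ _ Hat).
  unfold tangential_flux; pose proof (speed_pos _ _ Hat); field; lra.
Qed.

End Curve.

(** * Boundary conditions *)

Lemma Dt_ext_on T f g a b t :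
  (forall s, 0 <= s < T -> f a s = g b s) -> 0 < t < T -> Dt f a t = Dt g b t.
Proof.
  intros Hfg Ht; apply Derive_ext_loc.
  apply (filter_imp (fun s => 0 < s /\ s < T)).
  - intros s Hs; apply Hfg; lra.
  - apply filter_and; [apply open_gt | apply open_lt]; lra.
Qed.

Lemma cos_contact_angle gex ggas ggrs : 0 < gex -> Rabs (ggas - ggrs) <= gex ->
  gex * cos (theta_c gex ggas ggrs) = ggas - ggrs.
Proof.
  intros hg hy; unfold theta_c; rewrite cos_acos; [field; lra|].
  apply Rabs_le_between in hy.
  split; [apply Rle_div_r | apply Rle_div_l]; lra.
Qed.

Lemma cos_dihedral_angle gex ggb : 0 < gex -> 0 <= ggb < 2 * gex ->
  2 * gex * cos (beta gex ggb) = - ggb.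
Proof.
  intros hg hb; unfold beta; rewrite cos_acos; [field; lra|].
  split; [apply Rle_div_r | apply Rle_div_l]; lra.
Qed.

(** Equilibrium of the surface tensions at the triple junction: the directions
    [th1 + PI] and [th2] in which the exterior curves leave it make the angle
    [b], on either side, with the direction [th3 + PI] in which the grain
    boundary leaves it. *)
Lemma junction_balance gex ggb th1 th2 th3 b :
  2 * gex * cos b = - ggb -> - th1 + th3 = b -> th2 - th3 = - PI + b ->
  gex * (cos th1 - cos th2) + ggb * cos th3 = 0 /\
  gex * (sin th1 - sin th2) + ggb * sin th3 = 0.
Proof.
  intros Hb H1 H2.
  replace th1 with (th3 - b) by lra; replace th2 with (th3 + b - PI) by lra.
  rewrite cos_minus, sin_minus, (cos_minus (th3 + b)), (sin_minus (th3 + b)).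
  rewrite cos_PI, sin_PI, cos_plus, sin_plus.
  replace ggb with (- (2 * gex * cos b)) by lra.
  split; ring.
Qed.

Section Solution.
Variables (A B gex ggb ggas ggrs T : R) (C : configuration).
Hypothesis hsol : solution A B gex ggb ggas ggrs T C.

Lemma boundary_at t : 0 <= t < T -> boundary_conditions gex ggb ggas ggrs t C.
Proof. exact (boundary _ _ _ _ _ _ _ _ hsol t). Qed.

Lemma constraints_at t : 0 <= t < T -> geometric_constraints t C.
Proof. exact (constraints _ _ _ _ _ _ _ _ hsol t). Qed.

Lemma G1_positive_radius : positive_radius T (G1 C).
Proof.
  intros a t [Ha Ht]; exact (proj1 (r1_range _ _ (constraints_at t Ht) a Ha)).
Qed.

Lemma G2_positive_radius : positive_radius T (G2 C).
Proof.
  intros a t [Ha Ht]; destruct (Rle_lt_or_eq_dec a 1) as [Ha1 | ->]; [lra | |].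
  - apply (r2_range _ _ (constraints_at t Ht)); lra.
  - pose proof (G2_end _ _ _ _ _ _ (boundary_at t Ht)) as E; injection E as -> _; lra.
Qed.

Lemma G3_positive_radius : positive_radius T (G3 C).
Proof.
  intros a t [Ha Ht]; exact (proj1 (r3_range _ _ (constraints_at t Ht) a Ha)).
Qed.

Lemma junction_point s : 0 <= s < T ->
  (r (G2 C) 0 s = r (G1 C) 1 s /\ z (G2 C) 0 s = z (G1 C) 1 s) /\
  (r (G3 C) 1 s = r (G1 C) 1 s /\ z (G3 C) 1 s = z (G1 C) 1 s).
Proof.
  intros Hs.
  pose proof (G1_end _ _ _ _ _ _ (boundary_at s Hs)) as E1.
  pose proof (G2_start _ _ _ _ _ _ (boundary_at s Hs)) as E2.
  pose proof (G3_end _ _ _ _ _ _ (boundary_at s Hs)) as E3.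
  unfold point in *; repeat split; congruence.
Qed.

(** No mass leaves the exterior surface through its outer ends, and at the
    junction both the chemical potential and the mass flux match. *)
Lemma chemical_flux_balance t : 0 <= t < T ->
  (chemical_flux (G1 C) 1 t - chemical_flux (G1 C) 0 t)
  + (chemical_flux (G2 C) 1 t - chemical_flux (G2 C) 0 t) = 0.
Proof.
  intros Ht; destruct (boundary_at t Ht) as
    [_ _ _ _ _ _ _ _ _ _ _ _ _ _ _ _ _ Heq nf1 nf2 fb].
  destruct (junction_point t Ht) as [[Hr _] _].
  unfold chemical_flux; rewrite nf1, nf2, Heq, Hr.
  unfold Rdiv in *; rewrite !(Rmult_assoc _ (Da _ _ _)), fb; ring.
Qed.

Lemma exterior_area_loss_ge0 t : 0 <= B -> 0 < t < T ->
  0 <= RInt (fun a => area_loss (G1 C) a t) 0 1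
       + RInt (fun a => area_loss (G2 C) a t) 0 1.
Proof.
  intros hB Ht.
  pose proof (RInt_area_loss_surface_diffusion T (G1 C)
    (regular_1 _ _ _ _ _ _ _ _ hsol) G1_positive_radius B t hB
    (motion_1 _ _ _ _ _ _ _ _ hsol) Ht) as L1.
  pose proof (RInt_area_loss_surface_diffusion T (G2 C)
    (regular_2 _ _ _ _ _ _ _ _ hsol) G2_positive_radius B t hB
    (motion_2 _ _ _ _ _ _ _ _ hsol) Ht) as L2.
  refine (Rle_trans _ _ _ (Req_le _ _ _) (Rplus_le_compat _ _ _ _ L1 L2)).
  rewrite <- Rmult_plus_distr_l, chemical_flux_balance by lra; ring.
Qed.

Lemma boundary_work t :
  0 < gex -> 0 <= ggb < 2 * gex -> Rabs (ggas - ggrs) <= gex -> 0 < t < T ->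
  gex * ((tangential_flux (G1 C) 1 t - tangential_flux (G1 C) 0 t)
         + (tangential_flux (G2 C) 1 t - tangential_flux (G2 C) 0 t))
  + ggb * (tangential_flux (G3 C) 1 t - tangential_flux (G3 C) 0 t)
  + (ggas - ggrs) * r (G1 C) 0 t * Dt (r (G1 C)) 0 t = 0.
Proof.
  intros hgex hggb hyoung Ht; assert (Ht' : 0 <= t < T) by lra.
  assert (S0 : unit_slab T 0 t) by (split; lra).
  assert (S1 : unit_slab T 1 t) by (split; lra).
  rewrite !(tangential_flux_polar T (G1 C) (regular_1 _ _ _ _ _ _ _ _ hsol)),
    !(tangential_flux_polar T (G2 C) (regular_2 _ _ _ _ _ _ _ _ hsol)),
    !(tangential_flux_polar T (G3 C) (regular_3 _ _ _ _ _ _ _ _ hsol)) by assumption.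
  assert (V1 : Dt (z (G1 C)) 0 t = 0).
  { rewrite (Dt_ext_on T _ (fun _ _ => 0) 0 0 t); [exact (Derive_const _ _) | | exact Ht].
    intros s Hs; pose proof (G1_start _ _ _ _ _ _ (boundary_at s Hs)) as E.
    unfold point in E; congruence. }
  assert (V2 : Dt (r (G2 C)) 1 t = 0).
  { rewrite (Dt_ext_on T _ (fun _ _ => 1) 1 1 t); [exact (Derive_const _ _) | | exact Ht].
    intros s Hs; pose proof (G2_end _ _ _ _ _ _ (boundary_at s Hs)) as E.
    unfold point in E; congruence. }
  assert (V3 : Dt (z (G3 C)) 0 t = 0).
  { rewrite (Dt_ext_on T _ (fun _ _ => 0) 0 0 t); [exact (Derive_const _ _) | | exact Ht].
    intros s Hs; pose proof (G3_start _ _ _ _ _ _ (boundary_at s Hs)) as E.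
    unfold point in E; congruence. }
  rewrite V1, V2, V3,
    (Dt_ext_on T (r (G2 C)) (r (G1 C)) 0 1 t),
    (Dt_ext_on T (z (G2 C)) (z (G1 C)) 0 1 t),
    (Dt_ext_on T (r (G3 C)) (r (G1 C)) 1 1 t),
    (Dt_ext_on T (z (G3 C)) (z (G1 C)) 1 1 t)
    by (exact Ht || apply junction_point).
  destruct (junction_point t Ht') as [[-> _] [-> _]].
  destruct (boundary_at t Ht') as
    [_ _ _ _ _ _ _ _ _ _ _ _ ang1 ang2 ang3 ang13 ang23 _ _ _ _].
  rewrite ang1, ang2, ang3, sin_0, cos_PI2.
  destruct (junction_balance _ _ _ _ _ _ (cos_dihedral_angle _ _ hgex hggb) ang13 ang23)
    as [Jc Js].
  rewrite <- (cos_contact_angle _ _ _ hgex hyoung).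
  set (rt := Dt (r (G1 C)) 1 t); set (zt := Dt (z (G1 C)) 1 t).
  (* The contact line terms cancel; what remains is the work of the net tension
     at the junction along its velocity [(rt, zt)]. *)
  match type of Jc with ?X = 0 => match type of Js with ?Y = 0 =>
    transitivity (r (G1 C) 1 t * (rt * X + zt * Y)); [ring | rewrite Jc, Js; ring]
  end end.
Qed.

End Solution.

(** * Monotonicity of the energy *)

(** The sign of the derivative is not asked for at time [0], where only continuity
    matters. *)
Lemma nonincreasing_of_derive (f f' : R -> R) (T : R) :
  (forall t, 0 <= t < T -> is_derive f t (f' t)) ->
  (forall t, 0 < t < T -> f' t <= 0) ->
  forall t1 t2, 0 <= t1 -> t1 <= t2 -> t2 < T -> f t2 <= f t1.
Proof.
  intros Hd Hneg t1 t2 H1 H12 H2.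
  destruct (Rle_lt_or_eq_dec _ _ H12) as [Hlt|<-]; [|lra].
  destruct (MVT_cor2 f f' t1 t2 Hlt) as [c [Hc [Hc1 Hc2]]].
  - intros c Hc; apply is_derive_Reals, Hd; lra.
  - assert (Hle : f' c <= 0) by (apply Hneg; lra).
    assert (0 <= - f' c * (t2 - t1)) by (apply Rmult_le_pos; lra).
    lra.
Qed.

Theorem lemma3p1 (A B gex ggb ggas ggrs T : R) (C : configuration)
  (hA : 0 < A) (hB : 0 < B) (hgex : 0 < gex)
  (hggb : 0 <= ggb < 2 * gex) (hyoung : Rabs (ggas - ggrs) <= gex)
  (hT : 0 < T)
  (hsol : solution A B gex ggb ggas ggrs T C) :
  forall t1 t2 : R, 0 <= t1 -> t1 <= t2 -> t2 < T ->
    energy gex ggb ggas ggrs C t2 <= energy gex ggb ggas ggrs C t1.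
Proof.
  pose proof (regular_1 _ _ _ _ _ _ _ _ hsol) as reg1.
  pose proof (regular_2 _ _ _ _ _ _ _ _ hsol) as reg2.
  pose proof (regular_3 _ _ _ _ _ _ _ _ hsol) as reg3.
  pose proof (G1_positive_radius _ _ _ _ _ _ _ _ hsol) as pos1.
  pose proof (G2_positive_radius _ _ _ _ _ _ _ _ hsol) as pos2.
  pose proof (G3_positive_radius _ _ _ _ _ _ _ _ hsol) as pos3.
  (* Before time [0] the contact radius [r1s] is arbitrary, so it is replaced by
     the endpoint of [G1], which is smooth across [t = 0]. *)
  set (e := fun t => PI * ggrs + (ggas - ggrs) * PI * r (G1 C) 0 t ^ 2
    + gex * (surface_area (G1 C) t + surface_area (G2 C) t)
    + ggb * surface_area (G3 C) t).
  set (rate := fun G t => 2 * PI * (tangential_flux G 1 t - tangential_flux G 0 t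
    - RInt (fun a => area_loss G a t) 0 1)).
  set (e' := fun t => (ggas - ggrs) * PI * (2 * Dt (r (G1 C)) 0 t * r (G1 C) 0 t)
    + gex * (rate (G1 C) t + rate (G2 C) t) + ggb * rate (G3 C) t).
  assert (he : forall t, 0 <= t < T -> energy gex ggb ggas ggrs C t = e t).
  { intros t Ht.
    pose proof (G1_start _ _ _ _ _ _ (boundary_at _ _ _ _ _ _ _ _ hsol t Ht)) as E.
    injection E as E _; unfold energy, e, A_gas, A_grs, A_ex, A_gb; rewrite E; ring. }
  intros t1 t2 H1 H12 H2; rewrite !he by lra; clear he.
  apply (nonincreasing_of_derive e e' T); try assumption; clear t1 t2 H1 H12 H2.
  - intros t Ht.
    pose proof (is_derive_surface_area T (G1 C) reg1 pos1 t Ht) as D1.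
    pose proof (is_derive_surface_area T (G2 C) reg2 pos2 t Ht) as D2.
    pose proof (is_derive_surface_area T (G3 C) reg3 pos3 t Ht) as D3.
    assert (Dr : is_derive (fun s => r (G1 C) 0 s) t (Dt (r (G1 C)) 0 t)).
    { apply smooth_at_is_derive_t, (smooth_r _ _ reg1); split; lra. }
    unfold e, e'.
    evar_last.
    { exact (is_derive_plus _ _ _ _ _ (is_derive_plus _ _ _ _ _ (is_derive_plus _ _ _ _ _
        (is_derive_const (PI * ggrs) t) (is_derive_scal _ _ ((ggas - ggrs) * PI) _
          (is_derive_pow _ 2 _ _ Dr)))
        (is_derive_scal _ _ gex _ (is_derive_plus _ _ _ _ _ D1 D2)))
        (is_derive_scal _ _ ggb _ D3)). }
    unfold rate, plus, mult, zero; simpl; ring.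
  - intros t Ht.
    pose proof (boundary_work _ _ _ _ _ _ _ _ hsol t hgex hggb hyoung Ht) as Hwork.
    pose proof (exterior_area_loss_ge0 _ _ _ _ _ _ _ _ hsol t (Rlt_le _ _ hB) Ht) as L12.
    pose proof (RInt_area_loss_mean_curvature T (G3 C) reg3 pos3 A t (Rlt_le _ _ hA)
      (motion_3 _ _ _ _ _ _ _ _ hsol) Ht) as L3.
    unfold e', rate.
    set (I1 := RInt (fun a => area_loss (G1 C) a t) 0 1) in *.
    set (I2 := RInt (fun a => area_loss (G2 C) a t) 0 1) in *.
    set (I3 := RInt (fun a => area_loss (G3 C) a t) 0 1) in *.
    assert (Hloss : 0 <= 2 * PI * (gex * (I1 + I2) + ggb * I3)).
    { apply Rmult_le_pos; [generalize PI_RGT_0; lra|].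
      apply Rplus_le_le_0_compat; apply Rmult_le_pos; lra. }
    match type of Hwork with ?W = 0 => match goal with |- ?X <= 0 =>
      replace X with (2 * PI * W - 2 * PI * (gex * (I1 + I2) + ggb * I3)) by ring
    end end.
    rewrite Hwork; lra.
Qed.
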